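(* Let $d_0$ and $d_1$ be nonempty bitstrings (finite words over $\{0,1\}$) of the same length. Let $S_g$ be the set of positive integers $n$ such that $g(m,d_0,d_1) < g(n,d_0,d_1)$ for all positive integers $m<n$. Then a positive integer $n$ belongs to $S_g$ if and only if the binary representation of $n$ is either an alternating sequence of $0$'s and $1$'s, or an alternating sequence of $0$'s and $1$'s in which exactly one of the $0$'s is replaced with $00$.
   Context: The binary representation of a positive integer $n$ is its usual base-2 expansion written with the most significant bit first and without leading zeros (so it starts with $1$). A run is a maximal block of consecutive equal bits. An alternating sequence of $0$'s and $1$'s is a bitstring in which no two adjacent bits are equal (the single-bit string $1$ is included). For bitstrings $d_0,d_1$ and a positive integer $n$, $g(n,d_0,d_1)$ is the integer represented in base 2 by the bitstring obtained from the binary representation of $n$ by prepending $d_1$ immediately before (to the left of) each run of $1$'s and $d_0$ immediately before each run of $0$'s. Here the runs are those of the original binary representation of $n$. The resulting bitstring may have leading zeros (when $d_1$ starts with $0$), which do not affect the integer it represents. *)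

(* Defs.v *)
From mathcomp Require Import all_boot.
Set Implicit Arguments.
Unset Strict Implicit.
Unset Printing Implicit Defensive.

(* Bitstrings are [bitseq], most significant bit first: [true] is the digit 1
   and [false] the digit 0. *)

Definition nat_of_bits (s : bitseq) : nat :=
  foldl (fun v (b : bool) => v.*2 + b) 0 s.

(* For n > 0, the bits of weight 2 ^ k, ..., 2 ^ 0, where 2 ^ k <= n < 2 ^ k.+1.
   The value [:: false] at n = 0 is junk. *)
Definition binary (n : nat) : bitseq :=
  [seq odd (n %/ 2 ^ i) | i <- rev (iota 0 (trunc_log 2 n).+1)].

Fixpoint runs (s : bitseq) : seq bitseq :=
  if s is b :: s' then
    match runs s' with
    | (c :: r) :: rs =>
        if b == c then (b :: c :: r) :: rs else [:: b] :: (c :: r) :: rs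
    | _ => [:: [:: b]]
    end
  else [::].

Definition insert_runs (d0 d1 s : bitseq) : bitseq :=
  flatten [seq (if head false r then d1 else d0) ++ r | r <- runs s].

Definition g (n : nat) (d0 d1 : bitseq) : nat :=
  nat_of_bits (insert_runs d0 d1 (binary n)).

Definition Sg (d0 d1 : bitseq) (n : nat) : Prop :=
  0 < n /\ forall m : nat, 0 < m -> m < n -> g m d0 d1 < g n d0 d1.

Definition alternating (s : bitseq) : bool := sorted (fun a b => a != b) s.

Definition alternating_with_00 (s : bitseq) : Prop :=
  exists s1 s2 : bitseq,
    alternating (s1 ++ [:: false] ++ s2) /\
    s = s1 ++ [:: false; false] ++ s2.

Lemma nat_of_bits_binary (n : nat) : nat_of_bits (binary n) = n.
Proof.
have rcE s b : nat_of_bits (rcons s b) = (nat_of_bits s).*2 + b.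
  by rewrite /nat_of_bits foldl_rcons.
have key k : forall m, m < 2 ^ k ->
    nat_of_bits [seq odd (m %/ 2 ^ i) | i <- rev (iota 0 k)] = m.
  elim: k => [|k IHk] m lt_m; first by case: m lt_m.
  rewrite (iotaD 0 1 k) rev_cat map_cat /= cats1 rcE expn0 divn1.
  rewrite (iotaDl 1 0) -map_rev -map_comp.
  rewrite (eq_map (g := fun i => odd (m./2 %/ 2 ^ i))); last first.
    by move=> i /=; rewrite expnS divnMA divn2.
  rewrite IHk; first by rewrite addnC odd_double_half.
  by rewrite -divn2 ltn_divLR // mulnC -expnS.
by apply: key; apply: trunc_log_ltn.
Qed.

Lemma head_binary (n : nat) : 0 < n -> head false (binary n) = true.
Proof.
move=> n_gt0; rewrite /binary -[(trunc_log 2 n).+1]addn1 iotaD rev_cat /= add0n.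
have /andP[le_n lt_n] := trunc_log_bounds (isT : 1 < 2) n_gt0.
have -> : n %/ 2 ^ trunc_log 2 n = 1; last by [].
apply/eqP; rewrite eqn_leq -ltnS ltn_divLR ?expn_gt0 // -expnS lt_n /=.
by rewrite divn_gt0 ?expn_gt0.
Qed.

Lemma flatten_runs (s : bitseq) : flatten (runs s) = s.
Proof.
elim: s => //= b s; case E: (runs s) => [|[|c r] rs] /= IHs.
- by rewrite -IHs.
- case: s E {IHs} => //= a s; by case: (runs s) => [|[|? ?] ?] //; case: ifP.
- by case: eqP => _ /=; rewrite IHs.
Qed.

(* Main.v *)
Require Import Defs.
From mathcomp Require Import all_boot.
From mathcomp Require Import zify.

(** Write [L] for the common length of [d0] and [d1], and call a pair of equal
adjacent bits a repeat.  A word of length [l] with [k] repeats has [l - k]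
runs, so inserting the markers gives a word of length [(L + 1) l - L k].

All these inserted words start with [d1 1], which has a nonzero value.  Hence a
longer one has the larger value ([nat_of_bits_cat_lt]).  The same fact settles
the comparison of two words that first differ just after a [0] which one
continues by [1] and the other by [0]: past the common part, the former gives
[d1 1 X], and the latter, up to leading zeros, gives nothing or [d1 1 Y].  If
the whole inserted word of the former is at least as long, the zeros force
[Y] to be shorter than [X], so the former wins whatever [d1] is
([insert_runs_lt_after_zero]).

The two shapes of the theorem are the words with at most one repeat and no
[11].
- Let [s] have such a shape, and let [t] be smaller.  If [t] is shorter, its
  inserted word is shorter.  If the lengths agree, [s] continues by [1] where
  [t] first continues by [0]; the preceding bit is [0] since [s] has no [11],
  so [t] has a repeat, hence at least as many as [s], and the above comparison
  applies ([at_most_one_00_record]).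
- If [s] has another shape, look at its first repeat.  If it is [11], the
  alternating word of the same length is smaller than [s], and its inserted
  word is longer.  If it is [00], there is a further repeat, and the
  alternating word one bit shorter than [s] has an inserted word at least as
  long because [L >= 1]; it continues by [1] where [s] repeats its [0], so it
  beats [s] ([record_shape]). *)

(** * Values of bitstrings *)

Lemma nat_of_bits_cat (s t : bitseq) :
  nat_of_bits (s ++ t) = nat_of_bits s * 2 ^ size t + nat_of_bits t.
Proof.
elim/last_ind: t => [|t b IHt]; first by rewrite cats0 muln1 addn0.
have rcons_val u : nat_of_bits (rcons u b) = (nat_of_bits u).*2 + b.
  by rewrite /nat_of_bits foldl_rcons.
by rewrite -rcons_cat !rcons_val IHt size_rcons expnS; lia.
Qed.

Lemma nat_of_bits_cons (b : bool) (s : bitseq) :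
  nat_of_bits (b :: s) = b * 2 ^ size s + nat_of_bits s.
Proof. by rewrite -cat1s nat_of_bits_cat. Qed.

Lemma nat_of_bits_ltn (s : bitseq) : nat_of_bits s < 2 ^ size s.
Proof.
elim: s => [|b s IHs] //; rewrite nat_of_bits_cons /= expnS; case: b; lia.
Qed.

(** With [v > 0] the value of [u], the left side is below
[(v + 1) 2 ^ size x <= 2 v 2 ^ size x <= v 2 ^ size y]. *)
Lemma nat_of_bits_cat_lt (u x y : bitseq) :
  0 < nat_of_bits u -> size x < size y ->
  nat_of_bits (u ++ x) < nat_of_bits (u ++ y).
Proof.
move=> u_gt0 lt_xy; rewrite !nat_of_bits_cat.
have := nat_of_bits_ltn x.
have : 2 ^ (size x).+1 <= 2 ^ size y by rewrite leq_exp2l.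
rewrite expnS; nia.
Qed.

Lemma nat_of_bits_cat2l (u x y : bitseq) :
  size x = size y -> nat_of_bits x < nat_of_bits y ->
  nat_of_bits (u ++ x) < nat_of_bits (u ++ y).
Proof. by move=> eq_xy; rewrite !nat_of_bits_cat eq_xy ltn_add2l. Qed.

Lemma nat_of_bits_false_true (x y : bitseq) :
  size x = size y -> nat_of_bits (false :: x) < nat_of_bits (true :: y).
Proof.
move=> eq_xy; rewrite !nat_of_bits_cons -eq_xy mul0n mul1n.
by have := nat_of_bits_ltn x; lia.
Qed.

Lemma nat_of_bits_first_difference (s t : bitseq) :
  size s = size t -> nat_of_bits t < nat_of_bits s ->
  exists w x y : bitseq, s = w ++ true :: x /\ t = w ++ false :: y.
Proof.
elim: s t => [|b s IHs] [|c t] //= [eq_st].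
have [-> | neq_bc] := eqVneq b c.
  rewrite !nat_of_bits_cons -eq_st ltn_add2l => /(IHs t eq_st).
  by move=> [w [x [y [-> ->]]]]; exists (c :: w), x, y.
case: b c neq_bc => [] [] // _; first by exists [::], s, t.
by have := nat_of_bits_false_true s t eq_st; lia.
Qed.

Lemma nat_of_bits_inj (s t : bitseq) :
  size s = size t -> nat_of_bits s = nat_of_bits t -> s = t.
Proof.
elim: s t => [|b s IHs] [|c t] //= [eq_st].
rewrite !nat_of_bits_cons -eq_st => eq_val.
have lt_s := nat_of_bits_ltn s; have lt_t := nat_of_bits_ltn t.
rewrite -eq_st in lt_t.
have eq_bc : b = c by case: b c eq_val => [] []; lia.
by rewrite eq_bc (IHs t eq_st) //; move: eq_val; rewrite eq_bc => /addnI.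
Qed.

Lemma binary_nat_of_bits (s : bitseq) :
  binary (nat_of_bits (true :: s)) = true :: s.
Proof.
apply: nat_of_bits_inj; last exact: nat_of_bits_binary.
rewrite size_map size_rev size_iota /=; congr _.+1.
apply: trunc_log_eq => //; rewrite nat_of_bits_cons mul1n leq_addr /=.
by have := nat_of_bits_ltn s; rewrite expnS; lia.
Qed.

Lemma binary_cons (n : nat) : 0 < n -> exists s, binary n = true :: s.
Proof.
move=> /head_binary; case: (binary n) => [|b s] //= ->; by exists s.
Qed.

(** * Repeats *)

(** The repeats of [c :: s]. *)
Fixpoint repeats (c : bool) (s : bitseq) : nat :=
  if s is b :: s' then (c == b) + repeats b s' else 0.

Lemma repeats_cat (c : bool) (x y : bitseq) :
  repeats c (x ++ y) = repeats c x + repeats (last c x) y.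
Proof. by elim: x c => //= b x IHx c; rewrite IHx addnA. Qed.

Lemma alternating_repeats (c : bool) (s : bitseq) :
  alternating (c :: s) = (repeats c s == 0).
Proof.
rewrite /alternating /=; elim: s c => //= b s IHs c.
by rewrite IHs addn_eq0 eqb0.
Qed.

Lemma repeats_traject (c : bool) (k : nat) :
  repeats c (traject negb (~~ c) k) = 0.
Proof. by elim: k c => //= k IHk c; rewrite IHk; case: c. Qed.

Lemma first_repeat (c : bool) (s : bitseq) :
  0 < repeats c s ->
  exists x y : bitseq, s = x ++ last c x :: y /\ repeats c x = 0.
Proof.
elim: s c => //= b s IHs c; have [-> _ | neq_cb] := eqVneq c b.
  by exists [::], s.
rewrite add0n => /IHs [x [y [-> x_alt]]]; exists (b :: x), y.
by rewrite /= x_alt (negPf neq_cb).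
Qed.

(** Records are recognised from these two conditions alone: doubling a [0] of
an alternating word adds exactly one repeat and creates no [11]. *)
Lemma shape_at_most_one_00 (s : bitseq) :
  alternating (true :: s) \/ alternating_with_00 (true :: s) ->
  repeats true s <= 1 /\ path (fun a b => ~~ (a && b)) true s.
Proof.
have alt_no11 c x : repeats c x = 0 -> path (fun a b => ~~ (a && b)) c x.
  move/eqP; rewrite -alternating_repeats; apply: sub_path => a b.
  by case: a; case: b.
case=> [|[[|c s1] [s2 [s_alt]]] //= [eq_c eq_s]].
  by rewrite alternating_repeats => /eqP s_alt; rewrite s_alt; split=> //; auto.
move: s_alt; rewrite -eq_c eq_s cat_cons alternating_repeats => /eqP s_alt.
have := alt_no11 _ _ s_alt; rewrite !cat_path /=.
move: s_alt; rewrite !repeats_cat /= => s_alt /and3P[-> _ ->]; split.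
  by lia.
by rewrite andbF.
Qed.

(** * Inserting markers bit by bit *)

(** What the bits of [s] become when [c] is the bit before them; unlike
[insert_runs], this splits along concatenations. *)
Fixpoint insert_after (d0 d1 : bitseq) (c : bool) (s : bitseq) : bitseq :=
  if s is b :: s' then
    (if c == b then [::] else if b then d1 else d0) ++
      b :: insert_after d0 d1 b s'
  else [::].

Lemma insert_runs_cons (d0 d1 : bitseq) (c : bool) (s : bitseq) :
  insert_runs d0 d1 (c :: s) =
  (if c then d1 else d0) ++ c :: insert_after d0 d1 c s.
Proof.
(* The tail of the first run and the other runs are needed separately when a
   bit is added in front. *)
suff [r [rs [runs_s ->]]] : exists r rs, runs (c :: s) = (c :: r) :: rs /\
    insert_after d0 d1 c s = r ++
      flatten [seq (if head false r then d1 else d0) ++ r | r <- rs].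
  by rewrite /insert_runs runs_s /= -catA.
elim: s c => [|b s IHs] c; first by exists [::], [::].
have [r [rs [runs_s ins_s]]] := IHs b.
have -> : runs (c :: b :: s) = if c == b then (c :: b :: r) :: rs
    else [:: c] :: (b :: r) :: rs.
  by move: runs_s => /= ->.
rewrite /= ins_s; have [<- | _] := eqVneq c b; first by exists (c :: r), rs.
by exists [::], ((b :: r) :: rs); rewrite /= -catA.
Qed.

Lemma insert_after_cat (d0 d1 : bitseq) (c : bool) (x y : bitseq) :
  insert_after d0 d1 c (x ++ y) =
  insert_after d0 d1 c x ++ insert_after d0 d1 (last c x) y.
Proof. by elim: x c => //= b x IHx c; rewrite IHx -catA. Qed.

Lemma size_insert_after (d0 d1 : bitseq) (c : bool) (s : bitseq) :
  size d0 = size d1 ->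
  size (insert_after d0 d1 c s) + size d1 * repeats c s =
  (size d1).+1 * size s.
Proof.
move=> eq_d; elim: s c => [|b s IHs] c; first by rewrite !muln0.
rewrite /= size_cat /= mulnDr mulnS -(IHs b).
have -> : size (if c == b then [::] else if b then d1 else d0) =
    (c != b) * size d1 by case: (c == b); case: (b); rewrite /= ?mul1n.
by case: (c == b); lia.
Qed.

(** * Comparing words with markers *)

Lemma nat_of_bits_true_gt0 (u : bitseq) : 0 < nat_of_bits (u ++ [:: true]).
Proof. by rewrite nat_of_bits_cat addn_gt0 orbT. Qed.

Lemma insert_runs_lt_size (d0 d1 : bitseq) (s t : bitseq) :
  size (insert_after d0 d1 true t) < size (insert_after d0 d1 true s) ->
  nat_of_bits (insert_runs d0 d1 (true :: t)) <
  nat_of_bits (insert_runs d0 d1 (true :: s)).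
Proof.
move=> lt_ts; rewrite !insert_runs_cons -!(cat_rcons true) -!cats1.
exact: nat_of_bits_cat_lt (nat_of_bits_true_gt0 _) lt_ts.
Qed.

(** Zeros at the start of [y] only shorten what remains, until [y] ends or its
first [1] produces the same [d1 1] as the other word. *)
Lemma insert_after_false_lt (d0 d1 x y : bitseq) :
  size (insert_after d0 d1 false y) <
    size (insert_after d0 d1 false (true :: x)) ->
  nat_of_bits (insert_after d0 d1 false y) <
  nat_of_bits (insert_after d0 d1 false (true :: x)).
Proof.
have gt0 z : 0 < nat_of_bits (d1 ++ true :: z).
  rewrite -cat_rcons -cats1 nat_of_bits_cat addn_gt0 muln_gt0.
  by rewrite nat_of_bits_true_gt0 expn_gt0.
elim: y => [|[] y IHy] lt_yx; first exact: gt0.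
  move: lt_yx; rewrite /= -!(cat_rcons true) -!cats1 !(size_cat (_ ++ _)).
  by rewrite ltn_add2l; apply: nat_of_bits_cat_lt; apply: nat_of_bits_true_gt0.
by rewrite [X in X < _]nat_of_bits_cons; apply: IHy; apply: ltnW.
Qed.

Lemma insert_runs_lt_after_zero (d0 d1 w x y : bitseq) :
  last true w = false ->
  size (insert_after d0 d1 true (w ++ false :: y)) <=
    size (insert_after d0 d1 true (w ++ true :: x)) ->
  nat_of_bits (insert_runs d0 d1 (true :: w ++ false :: y)) <
  nat_of_bits (insert_runs d0 d1 (true :: w ++ true :: x)).
Proof.
move=> last_w; rewrite leq_eqVlt => /orP[/eqP eq_size | ].
  move: eq_size; rewrite !insert_runs_cons !insert_after_cat last_w.
  rewrite 2!(size_cat (insert_after d0 d1 true w)) => /addnI eq_size.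
  rewrite -!(cat_cons true) 2!(catA d1).
  apply: nat_of_bits_cat2l => //; rewrite [X in X < _]nat_of_bits_cons.
  by apply: insert_after_false_lt; rewrite -eq_size.
exact: insert_runs_lt_size.
Qed.

(** * Records *)

(** Shorter or not, counting repeats makes the inserted word of [t] no longer
than that of [s]: a missing bit costs [L + 1], more than the [L] lost by the
repeat that [s] may have, and at equal length [t] has a repeat too. *)
Lemma at_most_one_00_record (d0 d1 s t : bitseq) :
  size d0 = size d1 ->
  repeats true s <= 1 -> path (fun a b => ~~ (a && b)) true s ->
  nat_of_bits (true :: t) < nat_of_bits (true :: s) ->
  nat_of_bits (insert_runs d0 d1 (true :: t)) <
  nat_of_bits (insert_runs d0 d1 (true :: s)).
Proof.
move=> eq_d rep_s no11 lt_ts.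
have size_s := size_insert_after d0 d1 true s eq_d.
have size_t := size_insert_after d0 d1 true t eq_d.
case: (ltngtP (size t) (size s)) => [lt_size | gt_size | eq_size].
- by apply: insert_runs_lt_size; nia.
- by have := nat_of_bits_cat_lt [:: true] s t isT gt_size; rewrite /=; lia.
move: lt_ts; rewrite !nat_of_bits_cons eq_size ltn_add2l => lt_ts.
have [w [x [y [eq_s eq_t]]]] :=
  nat_of_bits_first_difference _ _ (esym eq_size) lt_ts.
have last_w : last true w = false.
  by move: no11; rewrite eq_s cat_path /= andbT => /and3P[_ /negPf].
have rep_t : 0 < repeats true t by rewrite eq_t repeats_cat last_w /=; lia.
rewrite eq_s eq_t; apply: insert_runs_lt_after_zero => //.
by rewrite -eq_s -eq_t; nia.
Qed.

(** Each competitor is alternating, so its inserted word is as long as its own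
length permits. *)
Lemma record_shape (d0 d1 s : bitseq) :
  d1 <> [::] -> size d0 = size d1 ->
  (forall t : bitseq, nat_of_bits (true :: t) < nat_of_bits (true :: s) ->
    nat_of_bits (insert_runs d0 d1 (true :: t)) <
    nat_of_bits (insert_runs d0 d1 (true :: s))) ->
  alternating (true :: s) \/ alternating_with_00 (true :: s).
Proof.
move=> d1_nonempty eq_d record.
have d1_gt0 : 0 < size d1 by case: (d1) d1_nonempty.
have size_s := size_insert_after d0 d1 true s eq_d.
have [s_alt | s_rep] := posnP (repeats true s).
  by left; rewrite alternating_repeats s_alt.
have [x [y [eq_s x_alt]]] := first_repeat _ _ s_rep.
case last_x: (last true x) eq_s => eq_s.
  (* First repeat [11]: the alternating word as long as [s] is smaller, since
     it has [0] in place of the second [1]. *)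
  pose t := x ++ traject negb false (size y).+1.
  have t_alt : repeats true t = 0.
    by rewrite repeats_cat x_alt last_x (repeats_traject true).
  have size_t := size_insert_after d0 d1 true t eq_d.
  have eq_size : size t = size s by rewrite eq_s !size_cat size_traject.
  have lt_ts : nat_of_bits (true :: t) < nat_of_bits (true :: s).
    rewrite eq_s -!cat_cons; apply: nat_of_bits_cat2l.
      by rewrite size_traject.
    by apply: nat_of_bits_false_true; rewrite size_traject.
  have := record t lt_ts; suff : nat_of_bits (insert_runs d0 d1 (true :: s)) <
    nat_of_bits (insert_runs d0 d1 (true :: t)) by lia.
  by apply: insert_runs_lt_size; nia.
have [y_alt | y_rep] := posnP (repeats false y).
  right; case/lastP: x x_alt last_x eq_s => // x b.
  rewrite last_rcons => + b0; rewrite b0 => x_alt ->.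
  exists (true :: x), y; split; last by rewrite /= cat_rcons.
  move: x_alt; rewrite cat_cons alternating_repeats -cats1 !repeats_cat /=.
  by rewrite y_alt !addn0 => ->.
(* First repeat [00], followed by another one: the alternating word one bit
   shorter than [s] loses [L + 1] where [s] loses at least [2 L]. *)
pose z := traject negb false (size y).-1; pose t := x ++ true :: z.
have y_gt0 : 0 < size y by case: (y) y_rep.
have t_alt : repeats true t = 0.
  by rewrite repeats_cat x_alt last_x /= (repeats_traject true).
have size_t := size_insert_after d0 d1 true t eq_d.
have eq_size : size s = (size t).+1.
  by rewrite eq_s !size_cat /= size_traject; lia.
have lt_ts : nat_of_bits (true :: t) < nat_of_bits (true :: s).
  by apply: (nat_of_bits_cat_lt [:: true]); rewrite ?eq_size.
have := record t lt_ts; suff : nat_of_bits (insert_runs d0 d1 (true :: s)) <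
  nat_of_bits (insert_runs d0 d1 (true :: t)) by lia.
rewrite eq_s; apply: insert_runs_lt_after_zero => //; rewrite -eq_s -/t.
have s_rep2 : 1 < repeats true s by rewrite eq_s repeats_cat last_x /=; lia.
by nia.
Qed.

Theorem theorem2 (d0 d1 : bitseq) (d0_nonempty : d0 <> [::])
    (d1_nonempty : d1 <> [::]) (same_length : size d0 = size d1)
    (n : nat) (n_gt0 : 0 < n) :
  Sg d0 d1 n <-> alternating (binary n) \/ alternating_with_00 (binary n).
Proof.
have [s eq_s] := binary_cons n n_gt0.
have eq_n : n = nat_of_bits (true :: s) by rewrite -eq_s nat_of_bits_binary.
rewrite /Sg /g eq_s; split=> [[_ record] | /shape_at_most_one_00[rep_s no11]].
  apply: (record_shape d0 d1) => // t lt_ts.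
  rewrite -[in X in X < _](binary_nat_of_bits t); apply: record.
    by rewrite nat_of_bits_cons mul1n addn_gt0 expn_gt0.
  by rewrite eq_n.
split=> // m m_gt0 lt_mn; have [t eq_t] := binary_cons m m_gt0.
rewrite eq_t; apply: at_most_one_00_record => //.
by rewrite -eq_n -eq_t nat_of_bits_binary.
Qed.
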